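(* Let $M < 3$ be a real number, let $d > 0$ be an integer, and let $G$ be a finite simple graph with $\mathrm{mad}(G) < M$. If $d > \frac{2}{3-M} - 2$, then $V(G)$ can be partitioned into sets $A$ and $B$ such that $A$ is an independent set of $G$ and $G[B]$ is a forest each of whose connected components has at most $d+1$ vertices.
   Context: $\mathrm{mad}(G) := \max_{H \subseteq G,\, V(H)\neq\emptyset} \frac{2|E(H)|}{|V(H)|}$ (maximum average degree over nonempty subgraphs). *)

(* Defs.v *)
From HB Require Import structures.
From mathcomp Require Import all_boot all_order all_algebra.
Set Implicit Arguments. Unset Strict Implicit. Unset Printing Implicit Defensive.
Import Order.TTheory GRing.Theory Num.Theory.

Definition simple_graph (T : finType) (e : rel T) : Prop :=
  irreflexive e /\ symmetric e.

Definition edges (T : finType) (e : rel T) : {set {set T}} :=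
  [set [set x; y] | x in T, y in T & e x y].

Definition is_subgraph (T : finType) (e : rel T) (S : {set T}) (F : {set {set T}}) : bool :=
  (F \subset edges e) && [forall f in F, f \subset S].

Local Open Scope ring_scope.

(* mad(G) = max over nonempty subgraphs H of 2|E(H)|/|V(H)| (value 0 if G has no vertices). *)
Definition mad (R : realFieldType) (T : finType) (e : rel T) : R :=
  \big[Num.max/0]_(S : {set T} | S != set0)
    \big[Num.max/0]_(F : {set {set T}} | is_subgraph e S F)
      ((2 * #|F|)%:R / #|S|%:R).

Local Close Scope ring_scope.

Definition independent (T : finType) (e : rel T) (A : {set T}) : bool :=
  [forall x in A, forall y in A, ~~ e x y].

Definition induced_rel (T : finType) (e : rel T) (B : {set T}) : rel T :=
  [rel x y | [&& x \in B, y \in B & e x y]].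

Definition is_forest (T : finType) (e : rel T) (B : {set T}) : Prop :=
  forall c : seq T, 3 <= size c -> ~ ucycle (induced_rel e B) c.

Definition component (T : finType) (e : rel T) (B : {set T}) (x : T) : {set T} :=
  [set y | connect (induced_rel e B) x y].

(* Main.v *)
(** Put N = d + 2. The density hypothesis says that (3N-2)|X| - 2N|E(X)| is
positive for every nonempty X. This is generalized to graphs in which some
vertices F are forced into B and every vertex x carries a weight J(x) (here 2):
call X's potential 3N|X| - J(X) - N|X :&: F| - 2N|E(X)|. If all nonempty X have
positive potential, there is an independent A avoiding F such that, once all
vertices of B are forced, every nonempty part of B still has positive potential.
For J = 2 this last condition says exactly that B induces a forest with
components of fewer than N vertices.

Induct on the number of vertices plus the number of free (unforced) vertices.
Forced vertices of degree at most 1 and free ones of degree at most 1 can be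
deleted. If all forced vertices have degree at least 2 and all free ones degree
at least 3, the potential of the whole graph is not positive. There remains a
free v with exactly two neighbours x and y: either v is put in A, forcing x and
y, or v is deleted and both x and y get heavier by J(v). Both moves keep all
potentials positive unless some S containing a free neighbour of v, but not v,
has potential at most N; such an S is coloured first, see [solve_boundary]. *)

Require Import Defs.
From HB Require Import structures.
From mathcomp Require Import all_boot all_order all_algebra.
From mathcomp Require Import zify lra.
Import Order.TTheory GRing.Theory Num.Theory.

Set Implicit Arguments.
Unset Strict Implicit.
Unset Printing Implicit Defensive.

Section Potential.

Variables (T : finType) (e : rel T).
Hypotheses (e_irr : irreflexive e) (e_sym : symmetric e).

Implicit Types (N t : nat) (J : T -> nat) (F G U S X Y P Q A : {set T}).

(** * Arc counts and potentials *)

Definition arcs X Y : nat := \sum_(x in X) \sum_(y in Y) e x y.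

Definition nbh x : {set T} := [set y | e x y].

Lemma arcsC X Y : arcs X Y = arcs Y X.
Proof.
rewrite /arcs exchange_big /=; apply: eq_bigr => y _.
by apply: eq_bigr => x _; rewrite e_sym.
Qed.

Lemma sum_disjointU (f : T -> nat) X Y : [disjoint X & Y] ->
  \sum_(x in X :|: Y) f x = \sum_(x in X) f x + \sum_(x in Y) f x.
Proof.
by move=> dXY; rewrite -bigU //; apply: eq_bigl => x; rewrite !inE.
Qed.

Lemma arcsUl X Y Q : [disjoint X & Y] -> arcs (X :|: Y) Q = arcs X Q + arcs Y Q.
Proof. by move=> dXY; rewrite /arcs sum_disjointU. Qed.

Lemma arcsUr X Y Q : [disjoint X & Y] -> arcs Q (X :|: Y) = arcs Q X + arcs Q Y.
Proof. by move=> dXY; rewrite !(arcsC Q) arcsUl. Qed.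

Lemma arcs1 x X : arcs [set x] X = #|X :&: nbh x|.
Proof.
rewrite /arcs big_set1 -sum1_card [RHS]big_mkcond [LHS]big_mkcond /=.
by apply: eq_bigr => y _; rewrite !inE; case: (y \in X); case: (e x y).
Qed.

Lemma arcs_sum_deg X : arcs X X = \sum_(x in X) #|X :&: nbh x|.
Proof.
apply: eq_bigr => x _; rewrite -arcs1 /arcs big_set1 //.
Qed.

Lemma arcs_gt0 x y X Y : x \in X -> y \in Y -> e x y -> 0 < arcs X Y.
Proof.
move=> xX yY exy; rewrite /arcs (bigD1 x) //= (bigD1 y) //= exy.
by rewrite -addnA.
Qed.

Lemma card_set1I x X : #|[set x] :&: X| = (x \in X).
Proof.
case: (boolP (x \in X)) => xX; last first.
  by apply/eqP; rewrite cards_eq0 setI_eq0 disjoints1.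
by rewrite (setIidPl _) ?cards1 // sub1set.
Qed.

(* [arcs X X] is twice the number of edges inside [X]. *)
Definition pot N J F X : int :=
  ((3 * N * #|X|)%:Z - (\sum_(x in X) J x)%:Z - (N * #|X :&: F|)%:Z
   - (N * arcs X X)%:Z)%R.

Lemma pot0 N J F : pot N J F set0 = 0%R.
Proof. by rewrite /pot /arcs !big_set0 set0I !cards0; lia. Qed.

Lemma potU N J F X Y : [disjoint X & Y] ->
  (pot N J F (X :|: Y) = pot N J F X + pot N J F Y - (2 * N * arcs X Y)%:Z)%R.
Proof.
move=> dXY; rewrite /pot arcsUl // !arcsUr // sum_disjointU // (arcsC Y X).
rewrite setIUl !cardsU.
have -> : (X :&: Y) = set0 by apply/eqP; rewrite setI_eq0.
have -> : X :&: F :&: (Y :&: F) = set0.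
  apply/eqP; rewrite setI_eq0; apply: disjointWl (subsetIl _ _) _.
  exact: disjointWr (subsetIl _ _) dXY.
rewrite cards0 !subn0; lia.
Qed.

Lemma pot1 N J F x :
  (pot N J F [set x] = (3 * N)%:Z - (J x)%:Z - (N * (x \in F))%:Z)%R.
Proof.
rewrite /pot arcs1 big_set1 cards1.
have -> : #|[set x] :&: F| = (x \in F).
  exact: card_set1I.
rewrite !card_set1I inE e_irr.
lia.
Qed.

Lemma potU1 N J F x X : x \notin X ->
  (pot N J F (x |: X) = pot N J F X + (3 * N)%:Z - (J x)%:Z
     - (N * (x \in F))%:Z - (2 * N * #|X :&: nbh x|)%:Z)%R.
Proof.
move=> xX; rewrite potU ?disjoints1 // pot1 arcs1. lia.
Qed.

(** Weight added at [x] is potential held in reserve: a set through [x] that stays positive after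
    the raise has potential above [t] before it. *)
Definition raise J t x : T -> nat := fun y => J y + t * (y == x).

Lemma pot_raise N J t x F X :
  (pot N (raise J t x) F X = pot N J F X - (t * (x \in X))%:Z)%R.
Proof.
rewrite /pot /raise big_split /= -big_distrr /=.
have -> : \sum_(y in X) (y == x : nat) = (x \in X).
  case: (boolP (x \in X)) => xX.
    rewrite (bigD1 x) //= eqxx big1 // => y /andP[_ /negbTE ->] //.
  by rewrite big1 // => y yX; case: eqP => // yx; rewrite -yx yX in xX.
lia.
Qed.

Lemma pot_force N J F G X :
  (pot N J (F :|: G) X = pot N J F X - (N * #|X :&: (G :\: F)|)%:Z)%R.
Proof.
rewrite /pot.
have -> : X :&: (F :|: G) = (X :&: F) :|: (X :&: (G :\: F)).
  by apply/setP => y; rewrite !inE; case: (y \in X); case: (y \in F).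
rewrite cardsU.
have -> : X :&: F :&: (X :&: (G :\: F)) = set0.
  by apply/setP => y; rewrite !inE; case: (y \in F); rewrite ?andbF.
rewrite cards0 subn0; lia.
Qed.

Lemma pot_forced N J F X : X \subset F -> pot N J F X = pot N J setT X.
Proof. by move=> /setIidPl XF; rewrite /pot XF setIT. Qed.

(** * Admissible sets and solutions *)

Definition admissible N J F U :=
  forall X, X \subset U -> X != set0 -> (0 < pot N J F X)%R.

Lemma admissible_ge0 N J F U X :
  admissible N J F U -> X \subset U -> (0 <= pot N J F X)%R.
Proof.
move=> adm XU; have [->|X0] := eqVneq X set0; first by rewrite pot0.
exact/ltW/adm.
Qed.

(* A part all of whose vertices are forced is acceptable for [B] iff it is
   admissible, hence the [setT] below. *)
Definition solvable N J F U :=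
  exists A, [/\ A \subset U, independent e A, A :&: F = set0
              & admissible N J setT (U :\: A)].

Lemma independentP A :
  reflect {in A &, forall x y, ~~ e x y} (independent e A).
Proof.
apply: (iffP forall_inP) => [iA x y xA yA | iA x xA].
  exact: (forall_inP (iA x xA)).
by apply/forall_inP => y yA; apply: iA.
Qed.

Lemma independentU1 x A :
  independent e A -> [disjoint A & nbh x] -> independent e (x |: A).
Proof.
move=> /independentP iA /disjointFr dAx.
have nx y : y \in A -> e x y = false by move=> /dAx; rewrite inE.
apply/independentP => y z /setU1P[->|yA] /setU1P[->|zA].
- by rewrite e_irr.
- by rewrite nx.
- by rewrite e_sym nx.
- exact: iA.
Qed.

(** * Reductions at vertices of small degree *)

Section Reductions.

Variable N : nat.

Lemma solvable_add J F U v A :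
    v \in U -> v \notin F -> A \subset U :\ v -> independent e A ->
    A :&: F = set0 -> [disjoint A & nbh v] ->
    admissible N J setT (U :\ v :\: A) ->
  solvable N J F U.
Proof.
move=> vU vF AU iA AF Av adm; exists (v |: A); split.
- by rewrite subUset sub1set vU (subset_trans AU) // subsetDl.
- exact: independentU1.
- by rewrite setIUl AF setU0; apply/eqP; rewrite setI_eq0 disjoints1.
- by rewrite -setDDl.
Qed.

Lemma solvable_force J F U v :
    v \in U -> v \notin F -> solvable N J (F :|: nbh v) (U :\ v) ->
  solvable N J F U.
Proof.
move=> vU vF [A [AU iA AF adm]]; apply: (solvable_add vU vF AU iA) => //.
  by apply/eqP; rewrite -subset0 -AF setIS // subsetUl.
by rewrite -setI_eq0 -subset0 -AF setIS // subsetUr.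
Qed.

Lemma solvable_keep J F U v A :
    v \in U -> A \subset U :\ v -> independent e A -> A :&: F = set0 ->
    admissible N J setT (U :\ v :\: A) ->
    (forall P, P \subset U :\ v :\: A -> (0 < pot N J setT (v |: P))%R) ->
  solvable N J F U.
Proof.
move=> vU AU iA AF adm admv; exists A; split=> //.
  exact: subset_trans AU (subsetDl _ _).
move=> P PU P0; have [vP|vP] := boolP (v \in P).
  rewrite -(setD1K vP); apply: admv; apply/subsetP => y.
  rewrite !inE => /andP[yv /(subsetP PU)]; rewrite !inE yv.
  by case/andP=> -> ->.
apply: adm => //; apply/subsetP => y yP; have := subsetP PU y yP.
by rewrite !inE => /andP[-> ->]; rewrite andbT; apply: contraNneq vP => <-.
Qed.

(** The induction measure. Its second summand drops when a vertex becomes forced even though none is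
    deleted, as can happen in [solve_boundary]. *)
Definition size_free F U := #|U| + #|U :\: F|.

Lemma size_freeD1 F G U v : v \in U -> size_free (F :|: G) (U :\ v) < size_free F U.
Proof.
move=> vU; rewrite /size_free (cardsD1 v U) vU add1n addSn ltnS leq_add2l.
by apply: subset_leq_card; apply: setDSS; rewrite ?subsetDl ?subsetUl.
Qed.

Lemma leaf_nbh U v : v \in U -> #|U :&: nbh v| <= 1 ->
  exists u, forall X, X \subset U :\ v -> #|X :&: nbh v| = (u \in X).
Proof.
move=> vU; have sub X : X \subset U :\ v -> X :&: nbh v = X :&: (U :&: nbh v).
  move=> /subsetD1P[XU _]; rewrite setIA (setIidPl XU) //.
case: (posnP #|U :&: nbh v|) => [/eqP/[!cards_eq0]/eqP U0 _|U1 U2].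
  (* Without neighbours, [v] itself serves as [u], since it lies in no such [X]. *)
  exists v => X XU; rewrite sub // U0 setI0 cards0.
  by have /subsetD1P[_ /negbTE->] := XU.
have /cards1P[u uU] : #|U :&: nbh v| == 1 by rewrite eqn_leq U1 U2.
by exists u => X XU; rewrite sub // uU setIC card_set1I.
Qed.

Lemma path_nbh U v : #|U :&: nbh v| = 2 ->
  exists x y, [/\ x != y, x \in U :&: nbh v, y \in U :&: nbh v
    & forall X, X \subset U :\ v -> #|X :&: nbh v| = (x \in X) + (y \in X)].
Proof.
case/eqP/cards2P=> x [y [xy Uxy]]; exists x, y; split=> //.
- by rewrite Uxy !inE eqxx.
- by rewrite Uxy !inE eqxx orbT.
move=> X /subsetD1P[XU _]; rewrite -(setIidPl XU) -setIA Uxy setIUr cardsU.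
rewrite -setIA [_ :&: (X :&: _)]setICA.
have -> : [set x] :&: [set y] = set0.
  by apply/eqP; rewrite setI_eq0 disjoints1 inE.
by rewrite !setI0 cards0 subn0 ![X :&: [set _]]setIC !card_set1I (setIidPl XU).
Qed.

Variables (J : T -> nat) (F U : {set T}).
Hypothesis U_adm : admissible N J F U.
Hypothesis IH : forall J' F' U', size_free F' U' < size_free F U ->
  admissible N J' F' U' -> solvable N J' F' U'.

(** A forced vertex brings [3N - N], exactly the price [2N] of its edge to [u]. Adding [v] to a set
    through [u] thus costs [J v], which a raise at [u] reserves; adding it to any other set gains
    [2N - J v > 0]. *)
Lemma solve_forced_leaf v : v \in U -> v \in F -> #|U :&: nbh v| <= 1 ->
  solvable N J F U.
Proof.
move=> vU vF /(leaf_nbh vU)[u uP].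
have Jv : (J v < 2 * N)%N.
  have := U_adm (X := [set v]); rewrite sub1set -card_gt0 cards1 pot1 vF.
  by move=> /(_ vU isT); lia.
have [] := @IH (raise J (J v) u) F (U :\ v).
- by have := size_freeD1 F set0 vU; rewrite setU0.
- move=> X XU X0; rewrite pot_raise.
  have /subsetD1P[XU' vX] := XU.
  have := U_adm (X := v |: X); rewrite potU1 // uP // vF subUset sub1set vU XU'.
  have := U_adm XU' X0; rewrite -card_gt0 cardsU1 vX.
  by case: (u \in X) => ? /(_ isT isT); lia.
move=> A [AU iA AF adm]; apply: (solvable_keep vU AU iA AF).
  by move=> X XU X0; have := adm X XU X0; rewrite pot_raise; lia.
move=> P PU; have PU' := subset_trans PU (subsetDl _ _).
have /subsetD1P[_ vP] := PU'.
rewrite potU1 // uP // inE; have := admissible_ge0 adm PU; rewrite pot_raise.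
have [uP'|uP'] := boolP (u \in P); last by lia.
have := adm P PU; rewrite pot_raise uP' -card_gt0 (cardD1 u) uP'.
by move=> /(_ isT); lia.
Qed.

(* [2 * N <= J v] makes [[set v]] inadmissible for [B]. *)
Lemma solve_forced_out v : v \in U -> v \notin F -> (2 * N <= J v)%N ->
  solvable N J F U.
Proof.
move=> vU vF Jv; apply: (solvable_force vU vF); apply: IH.
  exact: size_freeD1.
move=> X /[dup] XU /subsetD1P[XU' vX] X0; rewrite pot_force.
have := U_adm (X := v |: X); rewrite potU1 // (negbTE vF) subUset sub1set vU XU'.
rewrite -card_gt0 cardsU1 vX => /(_ isT isT).
have := U_adm XU' X0.
have : (#|X :&: (nbh v :\: F)| <= #|X :&: nbh v|)%N.
  by apply: subset_leq_card; rewrite setIS // subsetDl.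
(* If [X] contains [k > 0] neighbours of [v], positivity of [v |: X] gives [X] potential above
   [2Nk - N >= Nk], which pays for forcing them. *)
move: #|X :&: nbh v| #|X :&: (nbh v :\: F)| => [|a] b; first by lia.
by rewrite -(leq_pmul2l (ltn0Sn N)); nia.
Qed.

(** Any solution of the rest extends: [v] joins [A] unless [u] is there, and otherwise [v] is
    isolated in [B], where [J v < 2N] suffices. *)
Lemma solve_free_leaf v : v \in U -> v \notin F -> #|U :&: nbh v| <= 1 ->
  solvable N J F U.
Proof.
move=> vU vF /(leaf_nbh vU)[u uP].
have [|Jv] := leqP (2 * N) (J v); first exact: solve_forced_out.
have [] := @IH J F (U :\ v).
- by have := size_freeD1 F set0 vU; rewrite setU0.
- by move=> X /subsetD1P[XU _]; apply: U_adm.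
move=> A [AU iA AF adm].
have Av : #|A :&: nbh v| = (u \in A) by apply: uP.
case: (boolP (u \in A)) Av => [uA _|_ /eqP]; last first.
  by rewrite cards_eq0 setI_eq0 => Av; apply: (solvable_add vU vF AU).
apply: (solvable_keep vU AU iA AF adm) => P PU.
have PU' := subset_trans PU (subsetDl _ _); have /subsetD1P[_ vP] := PU'.
rewrite potU1 // uP // inE; have := admissible_ge0 adm PU.
have /negbTE-> : u \notin P by apply: contraL uA => /(subsetP PU); case/setDP.
by lia.
Qed.

(** * Sets of small potential next to a vertex *)

Lemma disjoint_setD X Y : [disjoint X & Y :\: X].
Proof. by rewrite -setI_eq0 setIDA setD_eq0 subsetIl. Qed.

Definition nbhs A : {set T} := [set y | [exists a in A, e a y]].

Lemma card_nbhs A X : #|X :&: nbhs A| <= arcs A X.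
Proof.
rewrite arcsC /arcs -sum1_card [X in X <= _]big_mkcond [X in _ <= X]big_mkcond.
apply: leq_sum => y _; rewrite !inE; case: (y \in X) => //=.
case: exists_inP => [[a aA ay]|//].
by rewrite (bigD1 a) //= e_sym ay.
Qed.

(* Take such an [S] of least potential [p], and solve it with [x] heavier by
   [p - 1]; then solve the rest, the vertices of [S] in [B] and the neighbours of
   those in [A] being forced. In this second problem a set [Q] outside [S] has
   potential at least [pot (S :|: Q) - p] plus a slack. If [v] is not in [Q], the
   difference is nonnegative by minimality; if it is, the edge [x v] provides a
   slack of at least [p]: [N] if [x] is in [A], and otherwise what the extra weight
   of [x] has reserved. *)
Lemma solve_boundary v x S1 :
    x \in U -> x \notin F -> v \in U -> e x v ->
    S1 \subset U -> x \in S1 -> v \notin S1 -> (pot N J F S1 <= N%:Z)%R ->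
  solvable N J F U.
Proof.
move=> xU xF vU exv SU0 xS0 vS0 pS0.
pose bd (Y : {set T}) := [&& Y \subset U, x \in Y & v \notin Y].
have : bd S1 by rewrite /bd SU0 xS0.
case/(arg_minP (pot N J F)) => S /and3P[SU xS vS] Smin.
have {pS0 SU0 xS0 vS0} : (pot N J F S <= N%:Z)%R.
  by apply: le_trans (Smin _ _) pS0; rewrite /bd SU0 xS0.
have S0 : S != set0 by apply/set0Pn; exists x.
have := U_adm SU S0; move Ep: (pot N J F S) => p p0 pN.
have {}Smin Y : Y \subset U -> x \in Y -> v \notin Y -> (p <= pot N J F Y)%R.
  by move=> YU xY vY; rewrite -Ep; apply: Smin; rewrite /bd YU xY.
have Sv : S \subset U :\ v by apply/subsetD1P.
(* [S] has potential [p] and its subsets through [x] at least [p], so [p - 1] is the largest raise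
   at [x] that keeps them all positive. *)
have [t tp] : exists t : nat, p = t.+1%:Z%R by exists `|p - 1|%N; lia.
have [] := @IH (raise J t x) F S.
- have := size_freeD1 F set0 vU; rewrite setU0; apply: leq_ltn_trans.
  by rewrite /size_free leq_add // subset_leq_card // setSD.
- move=> X XS X0; rewrite pot_raise; have XU := subset_trans XS SU.
  have [xX|xX] := boolP (x \in X); last by rewrite muln0 subr0; apply: U_adm.
  have vX : v \notin X by apply: contra vS; apply: (subsetP XS).
  by have := Smin X XU xX vX; rewrite muln1 tp; clear; lia.
move=> A [AS iA AF adm]; set B := S :\: A.
have AU := subset_trans AS SU.
have B_adm P : P \subset B -> P != set0 ->
    (0 < pot N J setT P)%R /\ (x \in P -> p <= pot N J setT P)%R.
  move=> PB P0; have := adm P PB P0; rewrite pot_raise tp; clear.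
  by case: (x \in P); rewrite ?muln1 ?muln0; lia.
have B_adm0 : admissible N J setT B by move=> P PB /(B_adm P PB)[].
have [] := @IH J (F :|: (B :|: nbhs A)) (U :\: A).
(* The measure drops either way: [x] is deleted if it is in [A], and becomes forced otherwise. *)
- rewrite /size_free; case: (boolP (x \in A)) => xA.
    have lt : #|U :\: A| < #|U|.
      apply/proper_card/properP; split; first exact: subsetDl.
      by exists x; rewrite // inE xA.
    by rewrite -addSn leq_add // subset_leq_card // setDSS ?subsetDl ?subsetUl.
  rewrite -addnS leq_add ?subset_leq_card ?subsetDl //.
  apply/proper_card/properP; split; first by rewrite setDSS ?subsetDl ?subsetUl.
  by exists x; rewrite !inE ?xF ?xU // xS xA orbT.
- move=> X XUA X0.
  have XU : X \subset U := subset_trans XUA (subsetDl _ _).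
  have PB : X :&: S \subset B.
    apply/subsetP => y; rewrite !inE => /andP[yX ->]; rewrite andbT.
    by have := subsetP XUA y yX; rewrite inE => /andP[].
  pose P := X :&: S; pose Q := X :\: S.
  have XE : X = P :|: Q by rewrite setID.
  have QU : Q \subset U := subset_trans (subsetDl _ _) XU.
  have dSQ : [disjoint S & Q] := disjoint_setD S X.
  have dPQ : [disjoint P & Q] := disjointWl (subsetIr _ _) dSQ.
  have dBQ : [disjoint B & Q] := disjointWl (subsetDl _ _) dSQ.
  have arcsS : arcs S Q = arcs A Q + (arcs P Q + arcs (B :\: P) Q).
    rewrite -(setID S A) (setIidPr AS) arcsUl -/B; last exact: disjoint_setD.
    rewrite -{1}(setID B P) (setIidPr PB) arcsUl //.
    exact: disjoint_setD.
  have SQ0 : S :|: Q != set0 by apply/set0Pn; exists x; rewrite inE xS.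
  have SQU : S :|: Q \subset U by rewrite subUset SU.
  have := U_adm SQU SQ0; have := Smin _ SQU; rewrite !in_setU xS (negbTE vS) /=.
  move=> /(_ isT); rewrite (potU _ _ _ dSQ) Ep arcsS => p_le pos.
  (* Each arc between [A] and [Q] costs [2N] in [S :|: Q] but nothing in [X]. Half of this pays for
     the newly forced vertices of [Q]; the other half is slack. *)
  have NQ : N * #|Q :&: ((B :|: nbhs A) :\: F)| <= N * arcs A Q.
    rewrite leq_mul2l (leq_trans _ (card_nbhs A Q)) ?orbT //.
    apply: subset_leq_card; apply/subsetP => y; rewrite in_setI => /andP[yQ].
    rewrite in_setD in_setU (disjointFl dBQ yQ) => /andP[_ yA].
    by rewrite in_setI yQ.
  have PF' : P \subset F :|: (B :|: nbhs A).
    by rewrite setUCA (subset_trans PB) // subsetUl.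
  rewrite XE (potU _ _ _ dPQ) (pot_forced _ _ PF') pot_force.
  have P_ge0 : (0 <= pot N J setT P)%R := admissible_ge0 B_adm0 PB.
  have Nr : (0 <= (N * arcs (B :\: P) Q)%:Z)%R by [].
  have N_mul n : 0 < n -> N <= N * n by apply: leq_pmulr.
  have [Q0|Q_neq0] := eqVneq Q set0.
    rewrite Q0 pot0 set0I cards0 arcsC /arcs big_set0 !muln0.
    have P0 : P != set0 by apply: contraNneq X0 => P0; rewrite XE P0 Q0 setU0.
    by have := B_adm0 P PB P0; clear; lia.
  have Q_pos := U_adm QU Q_neq0.
  have [vQ|vQ] := boolP (v \in Q).
    have [xA|xA] := boolP (x \in A).
      have := N_mul _ (arcs_gt0 xA vQ exv).
      by move: pos pN P_ge0 NQ Nr; clear; lia.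
    have [xP|xP] := boolP (x \in P).
      have P0 : P != set0 by apply/set0Pn; exists x.
      have /(_ xP) := (B_adm P PB P0).2.
      by move: pos pN P_ge0 NQ Nr; clear; lia.
    have xr : x \in B :\: P by rewrite inE xP inE xA.
    have := N_mul _ (arcs_gt0 xr vQ exv).
    by move: pos pN P_ge0 NQ Nr; clear; lia.
  have {}p_le := p_le vQ.
  (* Only strictness remains. It comes from a nonempty [P], from an arc between [A] and [Q], or,
     failing both, from [Q], whose potential is then unchanged. *)
  have [P0|P_neq0] := eqVneq P set0; last first.
    have := (B_adm P PB P_neq0).1.
    by move: p_le NQ Nr; clear; lia.
  have [a0|/N_mul] := posnP (arcs A Q); last first.
    by move: p_le p0 pN P_ge0 NQ Nr; clear; lia.
  move: NQ; rewrite a0 muln0 leqn0 => /eqP->; rewrite P0 pot0.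
  by rewrite /arcs big_set0; move: Q_pos; clear; lia.
move=> A' [A'U iA' /eqP A'F adm'].
move: A'F; rewrite !setIUr !setU_eq0 => /and3P[A'F A'B A'A].
have UAE : U :\: (A :|: A') = U :\: A :\: A' by rewrite setDDl.
exists (A :|: A'); rewrite UAE; split=> //.
- by rewrite subUset AU (subset_trans A'U) // subsetDl.
- have nAA' a a' : a \in A -> a' \in A' -> ~~ e a a'.
    move=> aA a'A; apply/negP => eaa; move: A'A; rewrite setI_eq0.
    move=> /disjointFr/(_ a'A)/negP[]; rewrite inE.
    by apply/exists_inP; exists a.
  move/independentP: iA => iA; move/independentP: iA' => iA'.
  apply/independentP => a b /setUP[aA|aA] /setUP[bA|bA].
  + exact: iA.
  + exact: nAA'.
  + by rewrite e_sym nAA'.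
  + exact: iA'.
- by rewrite setIUl AF set0U; apply/eqP.
Qed.

Lemma solve_or_boundary v x : v \in U -> x \in U :&: nbh v ->
  solvable N J F U \/ forall S, S \subset U -> x \in S -> x \notin F ->
    v \notin S -> (N%:Z < pot N J F S)%R.
Proof.
move=> vU; rewrite !inE e_sym => /andP[xU exv].
pose small S := [&& S \subset U, x \in S, x \notin F, v \notin S
                  & (pot N J F S <= N%:Z)%R].
have [/existsP[S /and5P[SU xS xF vS pS]]|/existsPn noS] := boolP [exists S, small S].
  by left; apply: (solve_boundary xU xF vU exv SU).
right=> S SU xS xF vS; rewrite ltNge; apply: contra (noS S) => pS.
by rewrite /small SU xS xF vS.
Qed.

(** A set through both [x] and [y] but not [v] has potential above [N + J v]. Forcing both costs
    [2N] and raising both costs [2 * J v], so comparing [J v] with [N] selects the move; if [x] or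
    [y] is already forced, forcing costs at most [N]. For sets through only one free neighbour, the
    bound [N] from [solve_or_boundary] suffices. *)
Lemma solve_free_path v : v \in U -> v \notin F -> #|U :&: nbh v| = 2 ->
  solvable N J F U.
Proof.
move=> vU vF /path_nbh[x [y [xy xU yU dvX]]].
have [|Jv] := leqP (2 * N) (J v); first exact: solve_forced_out.
have [//|big_x] := solve_or_boundary vU xU.
have [//|big_y] := solve_or_boundary vU yU.
have pot_v X : X \subset U :\ v -> X != set0 ->
    (0 < pot N J F X + (3 * N)%:Z - (J v)%:Z
         - (2 * N * ((x \in X) + (y \in X)))%:Z)%R.
  move=> XU X0; have /subsetD1P[XU' vX] := XU.
  have := U_adm (X := v |: X); rewrite potU1 // dvX // (negbTE vF) muln0 subr0.
  by rewrite subUset sub1set vU XU' -card_gt0 cardsU1 vX => /(_ isT isT).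
have [xyF|] := boolP [|| x \in F, y \in F | N <= J v].
  apply: (solvable_force vU vF); apply: IH; first exact: size_freeD1.
  move=> X XU X0; have /subsetD1P[XU' vX] := XU; rewrite pot_force.
  have XF : #|X :&: (nbh v :\: F)| <= (x \in X :\: F) + (y \in X :\: F).
    by rewrite setIDA -setIDAC dvX // (subset_trans (subsetDl _ _)).
  have := pot_v X XU X0; have := U_adm XU' X0.
  have bx xX xF := big_x X XU' xX xF vX; have by_ yX yF := big_y X XU' yX yF vX.
  move: bx by_ xyF XF; rewrite !inE; clear.
  move: #|_ :&: (_ :\: _)| => k.
  case: (x \in X); case: (y \in X); case: (x \in F); case: (y \in F) => /=;
  move=> bx by_; try have {}bx := bx isT isT; try have {}by_ := by_ isT isT;
  rewrite ?(addn0, addn1, muln1, muln0) => *; nia.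
rewrite !negb_or -ltnNge => /and3P[xF yF JvN].
have [] := @IH (raise (raise J (J v) x) (J v) y) F (U :\ v).
- by have := size_freeD1 F set0 vU; rewrite setU0.
- move=> X XU X0; have /subsetD1P[XU' vX] := XU; rewrite !pot_raise.
  have := pot_v X XU X0; have := U_adm XU' X0.
  have bx xX := big_x X XU' xX xF vX; have by_ yX := big_y X XU' yX yF vX.
  move: bx by_ JvN; clear.
  case: (x \in X); case: (y \in X) => bx by_;
  try have {}bx := bx isT; try have {}by_ := by_ isT;
  rewrite ?(addn0, addn1, muln1, muln0) => *; lia.
move=> A [AU iA AF adm].
have adm0 : admissible N J setT (U :\ v :\: A).
  by move=> X XU X0; have := adm X XU X0; rewrite !pot_raise; clear; lia.
have [xyA|] := boolP ((x \in A) || (y \in A)); last first.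
  rewrite negb_or => /andP[xA yA]; apply: (solvable_add vU vF AU) => //.
  by rewrite -setI_eq0 -cards_eq0 dvX // (negbTE xA) (negbTE yA).
apply: (solvable_keep vU AU iA AF adm0) => P PU.
have PU' := subset_trans PU (subsetDl _ _); have /subsetD1P[_ vP] := PU'.
rewrite potU1 // dvX // inE; have := admissible_ge0 adm PU; rewrite !pot_raise.
(* One of [x] and [y] is in [A], so [v] has at most one neighbour in [P], and the raise there pays
   for [J v]. *)
have : ~~ ((x \in P) && (y \in P)).
  apply: contraL xyA => /andP[/(subsetP PU) + /(subsetP PU)].
  by rewrite !inE negb_or => /andP[-> _] /andP[-> _].
have [P0 _ _|P0] := eqVneq P set0.
  by rewrite P0 !inE pot0; move: Jv; clear; lia.
have := adm P PU P0; rewrite !pot_raise.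
by move: Jv; clear; case: (x \in P); case: (y \in P) => //=; lia.
Qed.

End Reductions.

(** * Induction and the final degree count *)

Lemma admissible_solvable N J F U : admissible N J F U -> solvable N J F U.
Proof.
have [n] := ubnP (size_free F U); elim: n J F U => // n IHn J F U leUn U_adm.
have IH J' F' U' : size_free F' U' < size_free F U ->
    admissible N J' F' U' -> solvable N J' F' U'.
  by move=> lt; apply: IHn; apply: leq_trans lt _.
have [U0|U_neq0] := eqVneq U set0.
  exists set0; rewrite sub0set set0I; split=> //.
    by apply/independentP => x y; rewrite inE.
  by move=> X; rewrite U0 set0D subset0 => /eqP->; rewrite eqxx.
have [/exists_inP[v vU]|/exists_inPn big] :=
    boolP [exists v in U, (v \in F) + #|U :&: nbh v| <= 2].
  have [vF|vF] := boolP (v \in F); first exact: solve_forced_leaf.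
  rewrite add0n leq_eqVlt ltnS => /orP[/eqP|].
    exact: solve_free_path.
  exact: solve_free_leaf.
(* Every vertex now contributes at least 3 to the right-hand side, so the potential of [U] is at
   most minus its total weight, a contradiction. *)
have : 3 * #|U| <= #|U :&: F| + arcs U U.
  have -> : #|U :&: F| = \sum_(v in U) (v \in F).
    rewrite -sum1_card big_mkcond [RHS]big_mkcond; apply: eq_bigr => v _.
    by rewrite inE; case: (v \in U); case: (v \in F).
  rewrite arcs_sum_deg -big_split mulnC -sum_nat_const leq_sum // => v vU.
  by rewrite ltnNge big.
move=> /(leq_mul (leqnn N)).
by have := U_adm U (subxx _) U_neq0; rewrite /pot; clear; lia.
Qed.

(** * From positive potentials to small trees *)

(* Every vertex of a cycle has two neighbours on it, so the potential of its
   vertex set is at most [- 2 * #|P|]. *)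
Lemma acyclic_of_admissible N (B : {set T}) :
  admissible N (fun=> 2) setT B -> is_forest e B.
Proof.
move=> B_adm c c3 /andP[c_cyc c_uniq]; pose P := [set x in c].
have nbs x : x \in c -> x \in B /\ 2 <= #|P :&: nbh x|.
  (* With [x] rotated to the front, its neighbours on the cycle are the second vertex [y] and the
     last vertex [z], distinct because the length is at least 3. *)
  case/rot_to => i [|y [|y' s]] rot_c; move: (size_rot i c); rewrite rot_c.
  - by move=> c1; rewrite -c1 in c3.
  - by move=> c2; rewrite -c2 in c3.
  move=> _; move: c_cyc c_uniq; rewrite -(rot_cycle i) -(rot_uniq i) rot_c /=.
  rewrite rcons_path /=; set z := last y' s.
  case/and3P=> /and3P[xB _ xy] _ /andP[_ /and3P[_ _ zx]].
  case/and3P=> _ ys _; split=> //.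
  have zs : z \in y' :: s by apply: mem_last.
  have yz : y != z by apply: contraNneq ys => ->.
  have memP w : (w \in P) = (w \in [:: x, y, y' & s]).
    by rewrite inE -rot_c mem_rot.
  have -> : 2 = #|[set y; z]| by rewrite cards2 yz.
  apply: subset_leq_card; rewrite subUset !sub1set.
  have zP : z \in P by rewrite memP 2!in_cons zs !orbT.
  rewrite !in_setI zP memP 2!in_cons eqxx orbT !in_set xy.
  by rewrite e_sym zx.
have P0 : P != set0.
  case: c c3 @P {c_cyc c_uniq nbs} => // x c _.
  by apply/set0Pn; exists x; rewrite !inE eqxx.
have PB : P \subset B by apply/subsetP => x; rewrite inE => /nbs[].
have : \sum_(x in P) 2 <= arcs P P.
  by rewrite arcs_sum_deg; apply: leq_sum => x; rewrite inE => /nbs[].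
rewrite sum_nat_const => /(leq_mul (leqnn N)).
by have := B_adm P PB P0; rewrite /pot setIT sum_nat_const; clear; lia.
Qed.

(* Growing a connected set by an adjacent vertex lowers its potential by at least
   2, starting from [2 * N - 2] at [[set x]]. *)
Lemma card_component N (B : {set T}) x : 0 < N ->
  admissible N (fun=> 2) setT B -> x \in B -> #|component e B x| < N.
Proof.
move=> N0 B_adm xB.
pose K := component e B x.
pose good (P : {set T}) := [&& x \in P, P \subset K :&: B
  & pot N (fun=> 2%N) setT P <= (2 * N)%:Z - (2 * #|P|)%:Z]%R.
have : good [set x].
  rewrite /good set11 sub1set !inE xB connect0 pot1 cards1 inE.
  by clear; lia.
case/(arg_maxnP (fun P => #|P|)) => P /and3P[xP PKB pot_P] Pmax.
have PB := subset_trans PKB (subsetIr _ _).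
have P0 : P != set0 by apply/set0Pn; exists x.
have KP : K \subset P.
  have step u z : u \in P -> induced_rel e B u z -> z \in P.
    move=> uP uz; apply: contraT => zP.
    have /and3P[uB zB euz] := uz.
    suff /Pmax : good (z |: P) by rewrite /= cardsU1 zP add1n ltnn.
    have /setIP[uK _] := subsetP PKB u uP.
    rewrite /good inE xP orbT subUset sub1set PKB !inE zB /= andbT.
    rewrite (connect_trans _ (connect1 uz)) /=; last by rewrite inE in uK.
    rewrite potU1 // cardsU1 zP inE.
    have : 0 < #|P :&: nbh z|.
      by apply/card_gt0P; exists u; rewrite !inE uP e_sym.
    by move=> /(leq_mul (leqnn N)); move: pot_P; clear; lia.
  apply/subsetP => y; rewrite inE => /connectP[p + ->].
  elim: p x xP {xB K good Pmax PKB pot_P} => //= z p IHp x xP /andP[xz].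
  by apply: IHp; apply: step xz.
apply: leq_ltn_trans (subset_leq_card KP) _.
by have := B_adm P PB P0; move: pot_P; clear; lia.
Qed.

(** * From maximum average degree to potentials *)

(** Take for [E] all edges inside [S]. Mapping an adjacent ordered pair to its set of ends has
    fibres of size at most two, the two orderings. *)
Lemma arcs_double (S : {set T}) :
  exists2 E, is_subgraph e S E & arcs S S <= 2 * #|E|.
Proof.
pose p := setX S S :&: [set xy | e xy.1 xy.2].
pose ends (xy : T * T) := [set xy.1; xy.2].
exists (ends @: p).
  apply/andP; split.
    apply/subsetP => _ /imsetP[[x y] /setIP[_] + ->]; rewrite inE /= => exy.
    by apply/imset2P; exists x y => //; rewrite !inE.
  apply/forall_inP => _ /imsetP[[x y] /setIP[/setXP[xS yS] _] ->].
  by rewrite subUset !sub1set xS.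
have -> : arcs S S = \sum_(xy in p) 1.
  rewrite /arcs pair_big_dep /= [LHS]big_mkcond [RHS]big_mkcond.
  apply: eq_bigr => -[x y] _; rewrite !inE /=.
  by case: (x \in S); case: (y \in S); case: (e x y).
rewrite (partition_big_imset ends) /= mulnC -sum_nat_const.
apply: leq_sum => _ /imsetP[[x y] _ ->].
rewrite sum1dep_card (@leq_trans #|[set (x, y); (y, x)]|) //; last first.
  by rewrite cards2; case: eqP.
apply: subset_leq_card; apply/subsetP => -[a b].
rewrite !inE /ends /= !xpair_eqE => /andP[_ /eqP/setP ab].
move: (ab a) (ab b) (ab x) (ab y); rewrite !inE !eqxx !orbT /=.
rewrite ![x == _]eq_sym ![y == _]eq_sym.
by case: (a == x); case: (b == y); case: (a == y); case: (b == x).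
Qed.

End Potential.

Theorem theorem9 (R : realFieldType) (M : R) (d : nat) (T : finType) (e : rel T) :
  (M < 3)%R -> (0 < d)%N -> simple_graph e -> (mad R e < M)%R ->
  (2 / (3 - M) - 2 < d%:R)%R ->
  exists A B : {set T},
    [/\ A :&: B = set0, A :|: B = setT, independent e A, is_forest e B &
        forall x, x \in B -> #|component e B x| <= d.+1].
Proof.
move=> M3 d0 [e_irr e_sym] madM dM.
have : admissible e d.+2 (fun=> 2) set0 setT.
  move=> S _ S0; have [E SE arcsE] := arcs_double e S.
  have : ((2 * #|E|)%:R / #|S|%:R <= mad R e)%R.
    apply: (@bigmax_sup _ R _ 0%R S) => //.
    exact: (@bigmax_sup _ R _ 0%R E).
  move=> /le_lt_trans/(_ madM).
  have S_gt0 : (0 < #|S|%:R :> R)%R by rewrite ltr0n card_gt0.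
  rewrite ltr_pdivrMr // => lt_E.
  have dE : (d.+2%:R = d%:R + 2 :> R)%R by rewrite -addn2 natrD.
  (* With [N = d + 2], the bound on [d] reads [N(3 - M) > 2]. *)
  have lt_M : (d.+2%:R * M < 3 * d.+2%:R - 2)%R.
    have M3' : (0 < 3 - M)%R by rewrite subr_gt0.
    by move: dM; rewrite ltrBlDr ltr_pdivrMr // dE; lra.
  have : (d.+2%:R * (2 * #|E|)%:R < (3 * d.+2%:R - 2) * #|S|%:R :> R)%R.
    apply: (@lt_trans _ _ (d.+2%:R * M * #|S|%:R)%R); last by rewrite ltr_pM2r.
    by rewrite -mulrA ltr_pM2l.
  have -> : (3 * d.+2%:R - 2 = (3 * d + 4)%:R :> R)%R.
    by rewrite dE natrD natrM; lra.
  rewrite -!natrM ltr_nat /pot setI0 cards0 sum_nat_const.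
  have : d.+2 * arcs e S S <= d.+2 * (2 * #|E|) by rewrite leq_mul2l arcsE orbT.
  clear; lia.
case/(admissible_solvable e_irr e_sym) => A [_ iA _ B_adm].
exists A, (setT :\: A); split=> //.
- by rewrite setIDA setIT setDv.
- by rewrite setTD setUCr.
- exact: acyclic_of_admissible B_adm.
- by move=> x; apply: card_component B_adm.
Qed.
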